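(* Let $X$ be a real Hilbert space, let $A\colon X\rightrightarrows X$ and $B\colon X\rightrightarrows X$ be maximally monotone affine relations, and suppose that $Z=\{x\in X : 0\in Ax+Bx\}\neq\varnothing$. Let $x\in X$. Then the following hold: (i) $T_{\mathrm{DR}}^nx\to P_{\operatorname{Fix} T_{\mathrm{DR}}}x$ (in norm). (ii) Suppose that $A$ and $B$ are paramonotone and that $K\perp(Z-Z)$ (as is the case when $A$ and $B$ are paramonotone and $(\operatorname{zer}A)\cap(\operatorname{zer}B)\neq\varnothing$). Then $J_AT_{\mathrm{DR}}^nx\to P_Zx$. (iii) Suppose that $X$ is finite-dimensional. Then $T_{\mathrm{DR}}^nx\to P_{\operatorname{Fix} T_{\mathrm{DR}}}x$ linearly and $J_AT_{\mathrm{DR}}^nx\to J_AP_{\operatorname{Fix} T_{\mathrm{DR}}}x$ linearly.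
   Context: A set-valued operator $C\colon X\rightrightarrows X$ is monotone if $\langle x-y,u-v\rangle\ge 0$ for all $(x,u),(y,v)\in\operatorname{gra}C$, and maximally monotone if no monotone operator has a graph properly containing $\operatorname{gra} C$. $C$ is an affine relation if $\operatorname{gra}C$ is an affine subspace of $X\times X$ (a translate of a linear subspace). A monotone operator $C$ is paramonotone if whenever $(x,u),(y,v)\in\operatorname{gra}C$ and $\langle x-y,u-v\rangle=0$, then $(x,v),(y,u)\in\operatorname{gra}C$. $\operatorname{zer}C=C^{-1}(0)$, $J_C=(\mathrm{Id}+C)^{-1}$, $R_C=2J_C-\mathrm{Id}$. The Douglas–Rachford operator is $T_{\mathrm{DR}}=\mathrm{Id}-J_A+J_BR_A$. The dual solution set is $K=\big(A^{-1}+(-\mathrm{Id})\circ B^{-1}\circ(-\mathrm{Id})\big)^{-1}(0)$. $\operatorname{Fix}$ denotes the fixed point set and $P_C$ the projector onto a nonempty closed convex set $C$. $Z-Z=\{z_1-z_2 : z_1,z_2\in Z\}$, and $K\perp(Z-Z)$ means $\langle k,w\rangle=0$ for all $k\in K$, $w\in Z-Z$. A sequence $(y_n)$ converges linearly to $y_\infty$ if there exist $\mu\in[0,1)$ and $M\ge0$ with $\|y_n-y_\infty\|\le M\mu^n$ for all $n\in\mathbb N$. *)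

(* Defs.v *)
From HB Require Import structures.
From mathcomp Require Import all_boot all_order all_algebra.
From mathcomp Require Import boolp classical_sets reals topology normedtype.

Set Implicit Arguments.
Unset Strict Implicit.
Unset Printing Implicit Defensive.

Import Order.TTheory GRing.Theory Num.Theory.
Import numFieldNormedType.Exports.

Local Open Scope classical_set_scope.
Local Open Scope ring_scope.

Reserved Notation "''[' u , v ]" (format "''[' u ,  v ]").

(* Real Hilbert spaces: complete normed modules over R whose norm derives from
   an inner product. Positive definiteness follows from [inner_norm]. *)
HB.mixin Record NormedModule_isHilbert (R : realType) V
    & NormedModule R V := {
  inner : V -> V -> R ;
  innerC : forall x y, inner x y = inner y x ;
  innerDZl : forall y (a : R) u v,
    inner (a *: u + v) y = a * inner u y + inner v y ;
  inner_norm : forall x, inner x x = `|x| ^+ 2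
}.

#[short(type="hilbertType")]
HB.structure Definition Hilbert (R : realType) :=
  {V of CompleteNormedModule R V & NormedModule_isHilbert R V}.

Notation "''[' u , v ]" := (inner u v) : ring_scope.

Section InnerProductForm.
Context {R : realType} {X : hilbertType R}.

Lemma inner_bilinear :
  bilinear_for *%R (idfun \; *%R : R -> R -> R) (@inner R X).
Proof.
split=> [y a u v|y a u v] /=; first exact: innerDZl.
by rewrite innerC innerDZl !(innerC y).
Qed.

HB.instance Definition _ :=
  @bilinear_isBilinear.Build R X X R *%R (idfun \; *%R) (@inner R X)
    inner_bilinear.

Lemma inner_hermitian (x y : X) : '[x, y] = (-1) ^+ false * idfun '[y, x].
Proof. by rewrite expr0 mul1r /= innerC. Qed.

HB.instance Definition _ :=
  @isHermitianSesquilinear.Build R X false idfun (@inner R X) inner_hermitian.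

Lemma inner_gt0 (x : X) : x != 0 -> 0 < '[x, x].
Proof. by move=> x0; rewrite inner_norm exprn_gt0// normr_gt0. Qed.

HB.instance Definition _ := @isDotProduct.Build R X (@inner R X) inner_gt0.

End InnerProductForm.

Section SetValuedOperators.
Context {R : realType} {X : hilbertType R}.
Implicit Types (C A B : X -> set X) (S T : set X).

Definition gra C : set (X * X) := [set p | C p.1 p.2].

Definition op_inv C : X -> set X := fun u => [set x | C x u].

Definition op_add A B : X -> set X :=
  fun x => [set u + v | u in A x & v in B x].

(* (-Id) o C o (-Id) *)
Definition op_flip C : X -> set X := fun x => [set - u | u in C (- x)].

Definition zer C : set X := op_inv C 0.

Definition monotone C : Prop :=
  forall x u y v, gra C (x, u) -> gra C (y, v) -> 0 <= '[x - y, u - v].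

Definition maximally_monotone C : Prop :=
  monotone C /\ ~ exists2 D : X -> set X, monotone D & gra C `<` gra D.

Definition affine_relation C : Prop :=
  exists (p : X * X) (L : {pred X * X}),
    submod_closed L /\ gra C = [set p + z | z in [set` L]].

Definition paramonotone C : Prop :=
  monotone C /\
  forall x u y v, gra C (x, u) -> gra C (y, v) -> '[x - y, u - v] = 0 ->
    gra C (x, v) /\ gra C (y, u).

(* The set-valued resolvent (Id + C)^-1, and the map selecting its value. For a
   maximally monotone C every value of [resolvent_rel C] is a singleton
   (Minty); the default 0 is only reached when the value is empty. *)
Definition resolvent_rel C : X -> set X := op_inv (op_add (fun x => [set x]) C).

Definition resolvent C : X -> X := fun x => xget 0 (resolvent_rel C x).

Definition reflected_resolvent C : X -> X := fun x => 2 *: resolvent C x - x.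

Definition DR A B : X -> X :=
  fun x => x - resolvent A x + resolvent B (reflected_resolvent A x).

Definition primal_sol A B : set X := zer (op_add A B).

Definition dual_sol A B : set X := zer (op_add (op_inv A) (op_flip (op_inv B))).

Definition Fix (F : X -> X) : set X := [set x | F x = x].

(* Nearest point; unique as soon as S is nonempty, closed and convex. *)
Definition proj S : X -> X :=
  fun x => xget 0 [set p | S p /\ forall s, S s -> `|x - p| <= `|x - s|].

Definition pairwise_diff S T : set X := [set s - t | s in S & t in T].

Definition orthogonal_sets S T : Prop :=
  forall s t, S s -> T t -> '[s, t] = 0.

Definition linear_cvg (y : nat -> X) (l : X) : Prop :=
  exists mu M : R, [/\ 0 <= mu, mu < 1, 0 <= M &
    forall n, `|y n - l| <= M * mu ^+ n].

End SetValuedOperators.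

(* This unfolds [Vector.axiom n X] for some n; the norm is not involved, as
   all norms on a finite-dimensional real vector space are equivalent. *)
Definition finite_dimensional (R : realType) (X : hilbertType R) : Prop :=
  exists n (f : X -> 'rV[R]_n), linear f /\ bijective f.

(* Main.v *)
(* For a maximally monotone affine relation C the resolvent is everywhere
   defined: if y + u, with (y, u) in C, is the projection of w onto the closed
   affine set ran (Id + C), then z = w - (y + u) is orthogonal to its direction,
   so (y + z, u + z) is monotonically related to C, hence lies in C; thus
   y + u + 2z is in the range and z is orthogonal to 2z, i.e. z = 0. So T_DR is
   affine and firmly nonexpansive, and around a fixed point it is a linear N
   with '[N v, v - N v] >= 0. The vectors c with N^n c -> 0 form a closed
   subspace; it contains ran (Id - N) by asymptotic regularity and it is
   orthogonal to the fixed points, and what is orthogonal to it is fixed, so N^n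
   converges to the projector onto Fix N. In finite dimension Id - N is bounded
   below by some m > 0 on (Fix N)^perp, whence |N c|^2 <= (1 - m^2) |c|^2 there.
   For (ii), paramonotonicity gives Z + K = Fix T_DR, so that
   P_Fix x = a + k with k = P_Fix x - a in K orthogonal to Z - Z, and a = P_Z x. *)
From HB Require Import structures.
Require Import Defs.
From mathcomp Require Import all_boot all_order all_algebra.
From mathcomp Require Import boolp classical_sets reals topology normedtype.
From mathcomp Require Import sequences derive ring lra.
Import Order.TTheory GRing.Theory Num.Theory.
Import numFieldNormedType.Exports.
Local Open Scope classical_set_scope.
Local Open Scope ring_scope.

(** * Inner-product calculus and projection onto closed affine sets *)

Section Inner.
Set Implicit Arguments.
Unset Strict Implicit.
Context {R : realType} {X : hilbertType R}.
Implicit Types (u v w : X) (a : R).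

Lemma innerDl u v w : '[u + v, w] = '[u, w] + '[v, w].
Proof. exact: linearDl. Qed.
Lemma innerDr u v w : '[w, u + v] = '[w, u] + '[w, v].
Proof. exact: linearDr. Qed.
Lemma innerNl u w : '[- u, w] = - '[u, w].
Proof. exact: linearNl. Qed.
Lemma innerNr u w : '[w, - u] = - '[w, u].
Proof. exact: linearNr. Qed.
Lemma innerZl a u w : '[a *: u, w] = a * '[u, w].
Proof. exact: linearZl_LR. Qed.
Lemma innerZr a u w : '[w, a *: u] = a * '[w, u].
Proof. exact: linearZr_LR. Qed.

Definition innerE := (innerDl, innerDr, innerNl, innerNr, innerZl, innerZr).

Lemma inner_ge0 u : 0 <= '[u, u].
Proof. by rewrite inner_norm sqr_ge0. Qed.

Lemma inner_eq0 u : '[u, u] = 0 -> u = 0.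
Proof. by rewrite inner_norm => /eqP; rewrite sqrf_eq0 normr_eq0 => /eqP. Qed.

Lemma ler_normP u v : `|u| <= `|v| <-> '[u, u] <= '[v, v].
Proof. by rewrite !inner_norm ler_sqr ?nnegrE. Qed.

(** Vector identities below are proved by pairing with an arbitrary vector, which leaves scalar
    identities for [ring]. *)
Lemma inner_inj u v : (forall w, '[u, w] = '[v, w]) -> u = v.
Proof.
move=> uv; apply/eqP; rewrite -subr_eq0; apply/eqP/inner_eq0.
by rewrite !(innerDl, innerNl) !uv subrr.
Qed.

(** It turns minimality along a line into orthogonality. At [t = c / (q + 1)] the hypothesis reads
    [t ^+ 2 * (q + 1) <= t ^+ 2 * q], so [t] vanishes, and [c] with it. *)
Lemma linear_le_sqr_eq0 (c q : R) : (forall t, t * c <= t ^+ 2 * q) -> c = 0.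
Proof.
move=> h; have q0 : 0 <= q by move: (h 1) (h (-1)); lra.
have q1 : q + 1 != 0 by lra.
have ct : c = c / (q + 1) * (q + 1) by rewrite divfK.
move: (h (c / (q + 1))) (sqr_ge0 (c / (q + 1))); rewrite {2}ct.
move: ct; set t := c / (q + 1) => ct ht t2.
have /eqP : t ^+ 2 = 0 by lra.
by rewrite sqrf_eq0 ct => /eqP ->; rewrite mul0r.
Qed.

Lemma cauchy_seq_cvg (s : nat -> X) :
  (forall e : R, 0 < e -> exists N, forall n m, (N <= n)%N -> (N <= m)%N ->
     `|s n - s m| < e) -> exists l : X, s @ \oo --> l.
Proof.
move=> h; exists (lim (s @ \oo)).
apply: cauchy_cvg; apply: cauchy_exP => e e0.
have [N hN] := h e e0; exists (s N); exists N => // n /= Nn.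
by rewrite -ball_normE /=; exact: hN.
Qed.

Lemma cvg_seq_cauchy (s : nat -> X) (l : X) : s @ \oo --> l ->
  forall e : R, 0 < e -> exists N, forall n m, (N <= n)%N -> (N <= m)%N ->
     `|s n - s m| < e.
Proof.
move=> /cvgrPdist_lt h e e0; have [N _ hN] := h (e / 2) (divr_gt0 e0 (ltr0Sn _ 1)).
exists N => n m Nn Nm; rewrite (le_lt_trans (ler_distD l _ _))//.
by rewrite [e]splitr ltrD ?hN// distrC hN.
Qed.

(** By Pythagoras the squared distance from [x] to [s] exceeds that to [p] by the squared norm of
    [s - p], so [p] is the only nearest point. *)
Lemma proj_orth (S : set X) x p : S p ->
  (forall s, S s -> '[x - p, s - p] = 0) -> proj S x = p.
Proof.
move=> Sp orth; have key s : S s -> '[x - s, x - s] = '[x - p, x - p] + '[s - p, s - p].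
  move=> /orth h; have -> : x - s = (x - p) - (s - p) by rewrite opprB addrA subrK.
  by move: (x - p) (s - p) h => a b; rewrite !innerE (innerC b a); lra.
apply: xget_unique => [|q [Sq hq]].
  by split=> // s Ss; apply/ler_normP; rewrite (key _ Ss) lerDl inner_ge0.
have /ler_normP := hq _ Sp; rewrite (key _ Sq) => h.
apply/eqP; rewrite -subr_eq0; apply/eqP/inner_eq0.
by have := inner_ge0 (q - p); lra.
Qed.

(** These are the affine sets: [a] ranges over all of R, so the projection is characterised by
    equalities. *)
Definition line_closed (S : set X) :=
  forall s t a, S s -> S t -> S (s + a *: (t - s)).

Lemma proj_exists (S : set X) x : S !=set0 -> line_closed S ->
  (forall s l, (forall n : nat, S (s n)) -> s @ \oo --> l -> S l) ->
  exists2 p, S p & forall s, S s -> '[x - p, s - p] = 0.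
Proof.
move=> [s0 Ss0] lineS closedS.
have [d dS /choice [s hs]] : exists2 d, (forall s, S s -> d <= '[x - s, x - s])
    & forall n, exists s, S s /\ '[x - s, x - s] < d + n.+1%:R^-1.
  pose E := [set '[x - s, x - s] | s in S].
  have infE : has_inf E.
    split; first by exists '[x - s0, x - s0], s0.
    by exists 0 => _ [s _ <-]; exact: inner_ge0.
  exists (inf E) => [s Ss|n]; first by apply: ge_inf infE.2 _ _; exists s.
  have n0 : 0 < n.+1%:R^-1 :> R by rewrite invr_gt0.
  by have [_ [s Ss <-] hs] := inf_adherent n0 infE; exists s.
have dist n m : '[s n - s m, s n - s m] < 2 * n.+1%:R^-1 + 2 * m.+1%:R^-1.
  have [[Sn hn] [Sm hm]] := (hs n, hs m).
  have h := dS _ (lineS _ _ 2^-1 Sn Sm).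
  (* Parallelogram law; the last point is the midpoint of [s n] and [s m], which lies in [S] and so
     is at squared distance at least [d]. *)
  have -> : '[s n - s m, s n - s m] = 2 * '[x - s n, x - s n]
      + 2 * '[x - s m, x - s m] - 4 * '[x - (s n + 2^-1 *: (s m - s n)),
                                        x - (s n + 2^-1 *: (s m - s n))].
    by rewrite !innerE (innerC (s m) (s n)) !(innerC x); field.
  by move: n.+1%:R^-1 m.+1%:R^-1 hn hm h => e1 e2 hn hm h; lra.
have cauchy_s e : 0 < e -> exists N, forall n m, (N <= n)%N -> (N <= m)%N ->
    `|s n - s m| < e.
  move=> e0; have e20 : 0 < e ^+ 2 / 4 by rewrite divr_gt0 ?exprn_gt0.
  have /cvgrPdist_lt /(_ _ e20) [N _ hN] := @cvg_harmonic R.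
  exists N => n m Nn Nm; rewrite -ltr_sqr ?nnegrE ?(ltW e0)// -inner_norm.
  have := dist n m; have := hN n Nn; have := hN m Nm.
  rewrite /harmonic /= !sub0r !normrN !ger0_norm ?invr_ge0//.
  by move: n.+1%:R^-1 m.+1%:R^-1 => e1 e2 h2 h1 h; lra.
have [p sp] := cauchy_seq_cvg cauchy_s.
have Sp : S p by apply: (closedS s) => // n; case: (hs n).
have dp : '[x - p, x - p] <= d.
  have h1 : (fun n => `|x - s n| ^+ 2) @ \oo --> `|x - p| ^+ 2.
    have h2 : (fun n => `|x - s n|) @ \oo --> `|x - p|.
      by apply: cvg_norm; apply: cvgB => //; exact: cvg_cst.
    by under eq_fun do rewrite expr2; rewrite expr2; exact: cvgM.
  have h2 : (fun n => d + harmonic n) @ \oo --> d.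
    by rewrite -[X in _ --> X]addr0; apply: cvgD; [exact: cvg_cst|exact: cvg_harmonic].
  rewrite inner_norm; apply: (ler_cvg_to h1 h2); near=> n.
  by rewrite -inner_norm ltW//; case: (hs n).
(* Moving from [p] along the line to [t] cannot decrease the distance to [x]: twice [a *
   '[x - p, t - p]] is at most [a ^+ 2 * '[t - p, t - p]]. *)
exists p => // t St; apply: (@linear_le_sqr_eq0 _ ('[t - p, t - p] / 2)) => a.
have := dS _ (lineS _ _ a Sp St).
have -> : x - (p + a *: (t - p)) = (x - p) - a *: (t - p) by rewrite opprD addrA.
by move: (x - p) (t - p) dp => b c; rewrite !innerE (innerC c b); lra.
Unshelve. all: by end_near. Qed.
End Inner.

(** * Affine monotone relations, their resolvents and the Douglas-Rachford operator *)

Section Operators.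
Set Implicit Arguments.
Unset Strict Implicit.
Context {R : realType} {X : hilbertType R}.
Implicit Types (x y z u v w : X) (a : R) (C : X -> set X) (F : X -> X).

Lemma cvg_inner {T : Type} {G : set_system T} {FG : Filter G} (s t : T -> X)
    (l m : X) : s @ G --> l -> t @ G --> m ->
  (fun n => '[s n, t n]) @ G --> '[l, m].
Proof.
move=> sl tm.
(* Polarisation reduces the claim to continuity of the norm. *)
have polar u v : '[u, v] = 4^-1 * (`|u + v| * `|u + v| - `|u - v| * `|u - v|).
  by rewrite -!expr2 -!inner_norm !innerE (innerC v u); field.
under eq_fun do rewrite polar; rewrite polar.
apply: cvgM; first exact: cvg_cst.
have cD : (fun n => `|s n + t n|) @ G --> `|l + m| by apply: cvg_norm; exact: cvgD.
have cB : (fun n => `|s n - t n|) @ G --> `|l - m| by apply: cvg_norm; exact: cvgB.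
by apply: cvgB; exact: cvgM.
Qed.

Lemma affine_relation_comb C : affine_relation C ->
  forall a x u y v z w, C x u -> C y v -> C z w ->
    C (x + a *: (y - z)) (u + a *: (v - w)).
Proof.
move=> [p [L [[_ linL] graC]]] a x u y v z w.
have CE b c : C b c = exists2 l, l \in L & p + l = (b, c).
  by have := congr1 (fun S : set (X * X) => S (b, c)) graC.
rewrite !CE => -[l1 L1 E1] [l2 L2 E2] [l3 L3 E3].
exists (a *: ((- 1) *: l3 + l2) + l1); first by rewrite !linL.
have -> : p + (a *: ((- 1) *: l3 + l2) + l1) = (p + l1) + a *: ((p + l2) - (p + l3)).
  by rewrite scaleN1r opprD addrACA subrr add0r addrA addrAC -addrA (addrC l2) addrA.
by rewrite E1 E2 E3.
Qed.

Lemma affine_relation_nonempty C : affine_relation C -> exists x u, C x u.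
Proof.
move=> [p [L [[L0 _] graC]]]; exists p.1, p.2.
by have -> : C p.1 p.2 = gra C p by []; rewrite graC; exists 0; rewrite ?addr0.
Qed.

(** Otherwise adjoining [(x, u)] to the graph would give a proper monotone extension. *)
Lemma maximally_monotone_mem C x u : maximally_monotone C ->
  (forall y v, C y v -> 0 <= '[x - y, u - v]) -> C x u.
Proof.
move=> [monC maxC] hxu; apply: contrapT => nCxu; apply: maxC.
exists (fun y v => C y v \/ (y = x /\ v = u)).
  move=> y v z w; rewrite /gra /= => -[Cyv|[-> ->]] [Czw|[-> ->]].
  - exact: monC Cyv Czw.
  - by rewrite -(opprB x) -(opprB u) innerNl innerNr opprK hxu.
  - exact: hxu.
  - by rewrite subrr linear0l.
split=> [[y v] Cyv|sub]; first by left.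
by apply: nCxu; apply: (sub (x, u)); right.
Qed.

(** The monotonicity inequality against a fixed pair of the graph passes to the limit, and
    maximality concludes. *)
Lemma maximally_monotone_closed C (s t : nat -> X) (l m : X) :
  maximally_monotone C -> (forall n, C (s n) (t n)) ->
  s @ \oo --> l -> t @ \oo --> m -> C l m.
Proof.
move=> maxC Cst sl tm; apply: maximally_monotone_mem => // y v Cyv.
have h : (fun n => '[s n - y, t n - v]) @ \oo --> '[l - y, m - v].
  by apply: cvg_inner; apply: cvgB => //; exact: cvg_cst.
apply: (cvgr_to_ge h); near=> n; exact: maxC.1 (Cst n) Cyv.
Unshelve. all: by end_near. Qed.

Lemma minty_affine C w : maximally_monotone C -> affine_relation C ->
  exists y, C y (w - y).
Proof.
move=> maxC affC.
pose S := [set p.1 + p.2 | p in gra C].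
have [||s l Ss sl|_ [[y u] /= Cyu <-] orth] := @proj_exists _ _ S w.
- by have [y [u Cyu]] := affine_relation_nonempty affC; exists (y + u), (y, u).
- move=> _ _ a [[y u] /= Cyu <-] [[z v] /= Czv <-].
  exists (y + a *: (z - y), u + a *: (v - u)); first exact: affine_relation_comb.
  by apply: inner_inj => t; rewrite !innerE; ring.
- have /choice [p hp] : forall n, exists p, gra C p /\ p.1 + p.2 = s n.
    by move=> n; have [p Cp <-] := Ss n; exists p.
  (* The range is closed: by monotonicity the cross term is nonnegative, so both components of the
     pairs inherit the Cauchy property from their sums. *)
  have dist n m : '[(p n).1 - (p m).1, (p n).1 - (p m).1] <= '[s n - s m, s n - s m]
      /\ '[(p n).2 - (p m).2, (p n).2 - (p m).2] <= '[s n - s m, s n - s m].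
    have [[Cn <-] [Cm <-]] := (hp n, hp m).
    have := maxC.1 _ _ _ _ (Cn : C (p n).1 (p n).2) (Cm : C (p m).1 (p m).2).
    rewrite opprD addrACA; move: (_ - _) ((p n).2 - _) => b c bc.
    have [b0 c0] := (inner_ge0 b, inner_ge0 c).
    by rewrite !innerE (innerC c b); split; lra.
  have [|l1 cvg1] := @cauchy_seq_cvg _ _ (fun n => (p n).1).
    move=> e /(cvg_seq_cauchy sl) [N hN]; exists N => n m Nn Nm.
    by apply: le_lt_trans (hN n m Nn Nm); apply/ler_normP; case: (dist n m).
  have [|l2 cvg2] := @cauchy_seq_cvg _ _ (fun n => (p n).2).
    move=> e /(cvg_seq_cauchy sl) [N hN]; exists N => n m Nn Nm.
    by apply: le_lt_trans (hN n m Nn Nm); apply/ler_normP; case: (dist n m).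
  exists (l1, l2) => /=.
    by apply: (maximally_monotone_closed maxC _ cvg1 cvg2) => n; case: (hp n).
  have sl12 : s @ \oo --> l1 + l2.
    rewrite (_ : s = fun n => (p n).1 + (p n).2); first exact: cvgD.
    by apply/funext => n; case: (hp n).
  exact: cvg_unique sl12 sl.
- pose z := w - (y + u).
  (* Since [z] is orthogonal to [(y - y') + (u - u')], the inner product to bound is
     ['[y - y', u - u'] + '[z, z]]. *)
  have Cz : C (y + z) (u + z).
    apply: maximally_monotone_mem => // y' u' Cyu'.
    have := maxC.1 _ _ _ _ (Cyu : gra C (y, u)) (Cyu' : gra C (y', u')).
    have := orth _ (ex_intro2 _ _ (y', u') Cyu' erefl).
    have := inner_ge0 z; rewrite -/z /=.
    have -> : y' + u' - (y + u) = - ((y - y') + (u - u')).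
      by apply: inner_inj => t; rewrite !innerE; ring.
    rewrite !(addrAC _ z); move: z (y - y') (u - u') => z b c.
    by rewrite !innerE (innerC b z); lra.
  have z0 : z = 0.
    apply: inner_eq0; have := orth _ (ex_intro2 _ _ (y + z, u + z) Cz erefl).
    rewrite -/z /= opprD addrACA !(addrAC _ z) !subrr !add0r innerDr; lra.
  exists y; suff -> : w - y = u by [].
  by apply/eqP; rewrite -subr_eq0 -addrA -opprD -/z z0.
Qed.

Lemma resolvent_relE C x y : resolvent_rel C x y = C y (x - y).
Proof.
rewrite propeqE; split=> [[_ -> [v Cyv <-]]|Cy]; first by rewrite addrC addKr.
by exists y => //; exists (x - y) => //; rewrite addrC subrK.
Qed.

(** For a second value [z], monotonicity makes [- '[z - y, z - y]] nonnegative; hence exhibiting one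
    value computes the resolvent. *)
Lemma resolvent_eq C x y : monotone C -> C y (x - y) -> resolvent C x = y.
Proof.
move=> monC Cy; apply: xget_unique; first by rewrite resolvent_relE.
move=> z; rewrite resolvent_relE => Cz.
apply/eqP; rewrite -subr_eq0; apply/eqP/inner_eq0.
have := monC _ _ _ _ (Cz : gra C (z, x - z)) (Cy : gra C (y, x - y)).
have -> : x - z - (x - y) = - (z - y) by apply: inner_inj => t; rewrite !innerE; ring.
by have := inner_ge0 (z - y); rewrite innerNr; lra.
Qed.

(** In this form, firm nonexpansiveness of the resolvent of [C] is literally monotonicity of [C] at
    the resolvent pairs. *)
Definition firmly_nonexpansive F :=
  forall x y, 0 <= '[F x - F y, (x - F x) - (y - F y)].

Definition affine_map F :=
  forall a x y z, F (x + a *: (y - z)) = F x + a *: (F y - F z).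

Lemma firmly_nonexpansive_le F x y : firmly_nonexpansive F ->
  '[F x - F y, F x - F y] + '[(x - F x) - (y - F y), (x - F x) - (y - F y)]
    <= '[x - y, x - y].
Proof.
move=> /(_ x y).
have -> : x - y = (F x - F y) + ((x - F x) - (y - F y)).
  by apply: inner_inj => t; rewrite !innerE; ring.
by move: (F x - F y) (x - F x - _) => b c; rewrite !innerE (innerC c b); lra.
Qed.

Lemma firmly_nonexpansive_dist F x y : firmly_nonexpansive F ->
  `|F x - F y| <= `|x - y|.
Proof.
move=> firmF; apply/ler_normP.
have := firmly_nonexpansive_le x y firmF.
by have := inner_ge0 (x - F x - (y - F y)); lra.
Qed.

Lemma firmly_nonexpansive_cvg F (s : nat -> X) (l : X) : firmly_nonexpansive F ->
  s @ \oo --> l -> (fun n => F (s n)) @ \oo --> F l.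
Proof.
move=> firmF /cvgrPdist_lt sl; apply/cvgrPdist_lt => e e0.
apply: filterS (sl e e0) => n /=; apply: le_lt_trans.
exact: firmly_nonexpansive_dist.
Qed.

Section Resolvent.
Variables (C : X -> set X) (maxC : maximally_monotone C) (affC : affine_relation C).

Lemma resolvent_mem x : C (resolvent C x) (x - resolvent C x).
Proof.
by have [y Cy] := minty_affine x maxC affC; rewrite (resolvent_eq maxC.1 Cy).
Qed.

Lemma resolvent_firm : firmly_nonexpansive (resolvent C).
Proof. by move=> x y; exact: maxC.1 (resolvent_mem x) (resolvent_mem y). Qed.

Lemma resolvent_affine : affine_map (resolvent C).
Proof.
move=> a x y z; apply: resolvent_eq; first exact: maxC.1.
have := affine_relation_comb affC a
  (resolvent_mem x) (resolvent_mem y) (resolvent_mem z).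
by congr C; apply: inner_inj => t; rewrite !innerE; ring.
Qed.
End Resolvent.

Section DouglasRachford.
Variables (A B : X -> set X).
Hypotheses (maxA : maximally_monotone A) (affA : affine_relation A).
Hypotheses (maxB : maximally_monotone B) (affB : affine_relation B).

(** The quantity to bound is exactly the sum of the firmness quantities of the resolvent of [A] at
    [x], [y] and of the resolvent of [B] at their reflections. *)
Lemma DR_firm : firmly_nonexpansive (DR A B).
Proof.
move=> x y; have := resolvent_firm maxA affA x y.
have := resolvent_firm maxB affB (reflected_resolvent A x) (reflected_resolvent A y).
rewrite /DR; set a := resolvent A x; set a' := resolvent A y.
rewrite /reflected_resolvent -/a -/a'; set b := resolvent B _; set b' := resolvent B _.
move=> h1 h2; have := addr_ge0 h1 h2; congr (0 <= _).
rewrite !innerE !(innerC b) !(innerC b') !(innerC a) !(innerC a').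
ring.
Qed.

Lemma DR_affine : affine_map (DR A B).
Proof.
move=> a x y z; rewrite /DR /reflected_resolvent (resolvent_affine maxA affA).
set u := resolvent A x; set v := resolvent A y; set w := resolvent A z.
have -> : 2 *: (u + a *: (v - w)) - (x + a *: (y - z)) =
    (2 *: u - x) + a *: ((2 *: v - y) - (2 *: w - z)).
  by apply: inner_inj => t; rewrite !innerE; ring.
rewrite (resolvent_affine maxB affB).
by apply: inner_inj => t; rewrite !innerE; ring.
Qed.

Lemma Fix_DR z k : A z k -> B z (- k) -> Fix (DR A B) (z + k).
Proof.
move=> Azk Bzk; have JA : resolvent A (z + k) = z.
  by apply: resolvent_eq maxA.1 _; rewrite addrC addKr.
rewrite /Fix /= /DR /reflected_resolvent JA (@resolvent_eq B _ z) ?addrNK//.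
  exact: maxB.1.
by have -> : 2 *: z - (z + k) - z = - k by apply: inner_inj => t; rewrite !innerE; ring.
Qed.

(** Being fixed means that both resolvents return the same point, so [y] splits as a primal plus a
    dual solution, conversely to [Fix_DR]. *)
Lemma Fix_DR_split y : Fix (DR A B) y ->
  A (resolvent A y) (y - resolvent A y) /\ B (resolvent A y) (- (y - resolvent A y)).
Proof.
move=> fixy; split; first exact: resolvent_mem.
have JB : resolvent B (reflected_resolvent A y) = resolvent A y.
  move/eqP: fixy; rewrite /DR /= -addrA -subr_eq0 addrAC subrr add0r addrC.
  by rewrite subr_eq0 => /eqP.
have := resolvent_mem maxB affB (reflected_resolvent A y); rewrite JB.
congr B; rewrite /reflected_resolvent.
by apply: inner_inj => t; rewrite !innerE; ring.
Qed.

(** Primal and dual solutions are the two projections of one set of pairs [(z, k)], those whose sums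
    are the fixed points. *)
Lemma primal_solE z : primal_sol A B z <-> exists2 k, A z k & B z (- k).
Proof.
split=> [[u Au [v Bv /eqP]]|[k Ak Bk]].
  by rewrite addrC addr_eq0 => /eqP vE; exists u; rewrite -?vE.
by exists k => //; exists (- k) => //; rewrite subrr.
Qed.

Lemma dual_solE k : dual_sol A B k <-> exists2 z, A z k & B z (- k).
Proof.
split=> [[z Az [_ [w Bw <-] /eqP]]|[z Az Bz]].
  by rewrite subr_eq0 => /eqP zw; exists z => //; rewrite zw.
by exists z => //; exists (- z); [exists z|rewrite subrr].
Qed.

(* Monotonicity of A and of B bounds '[z - a, u - k] from both sides. *)
Lemma paramonotone_sol z k : paramonotone A -> paramonotone B ->
  primal_sol A B z -> dual_sol A B k -> A z k /\ B z (- k).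
Proof.
move=> [monA paraA] [monB paraB] /primal_solE [u Azu Bzu] /dual_solE [a Aak Bak].
have hA := monA _ _ _ _ (Azu : gra A (_, _)) (Aak : gra A (_, _)).
have hB := monB _ _ _ _ (Bzu : gra B (_, _)) (Bak : gra B (_, _)).
have hAB : '[z - a, - u - - k] = - '[z - a, u - k] by rewrite -innerNr opprD.
have h0 : '[z - a, u - k] = 0 by lra.
by split; [have [] := paraA _ _ _ _ Azu Aak h0|
  have [] := paraB _ _ _ _ Bzu Bak; rewrite ?hAB ?h0 ?oppr0].
Qed.
End DouglasRachford.
End Operators.

(** * Iterates of a firmly nonexpansive linear map *)

Section Iterates.
Set Implicit Arguments.
Unset Strict Implicit.
Context {R : realType} {X : hilbertType R}.
Variable N : {linear X -> X}.
Hypothesis firmN : forall v, 0 <= '[N v, v - N v].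

Lemma linear_firm_le v : '[N v, N v] + '[v - N v, v - N v] <= '[v, v].
Proof.
have -> : '[v, v] = '[N v + (v - N v), N v + (v - N v)] by rewrite addrC subrK.
have := firmN v; move: (N v) (v - N v) => b c.
by rewrite !innerE (innerC c b); lra.
Qed.

Lemma linear_firm_norm v : `|N v| <= `|v|.
Proof.
by apply/ler_normP; have := linear_firm_le v; have := inner_ge0 (v - N v); lra.
Qed.

Lemma iterB n u v : iter n N (u - v) = iter n N u - iter n N v.
Proof. by elim: n => //= n ->; rewrite linearB. Qed.

Lemma iterPZ n a u v : iter n N (a *: u + v) = a *: iter n N u + iter n N v.
Proof. by elim: n => //= n ->; rewrite linearP. Qed.

Lemma iter_norm n v : `|iter n N v| <= `|v|.
Proof. by elim: n => //= n; apply: le_trans; exact: linear_firm_norm. Qed.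

(* Firmness at v + t f reads 0 <= '[N v, v - N v] + t '[f, v - N v] for all t. *)
Lemma Fix_orth_range f v : N f = f -> '[f, v - N v] = 0.
Proof.
move=> Nf; have h t : 0 <= '[N v, v - N v] + t * '[f, v - N v].
  have := firmN (t *: f + v); rewrite linearP Nf.
  have -> : t *: f + v - (t *: f + N v) = v - N v by rewrite opprD addrACA subrr add0r.
  by rewrite innerDl innerZl addrC.
move: h; move: '[N v, _] '[f, _] => p q h; apply: contrapT => /eqP q0.
by have := h (- (p + 1) / q); rewrite divfK//; lra.
Qed.

(** The squared norms of the iterates of [v] decrease to a limit, and their decrements dominate the
    squared norms considered here. *)
Lemma asymptotic_regularity v :
  (fun n => iter n N (v - N v)) @ \oo --> (0 : X).
Proof.
pose b n := '[iter n N v, iter n N v].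
have step n : '[iter n N (v - N v), iter n N (v - N v)] <= b n - b n.+1.
  rewrite iterB -iterSr /b /=; have := linear_firm_le (iter n N v); lra.
have /cvg_ex [l bl] : cvgn b.
  apply: nonincreasing_is_cvgn.
    apply/nonincreasing_seqP => n; have := step n.
    by have := inner_ge0 (iter n N (v - N v)); lra.
  by exists 0 => _ [n _ <-]; exact: inner_ge0.
have b0 : (fun n => b n - b n.+1) @ \oo --> 0.
  by rewrite -(subrr l); apply: cvgB => //; rewrite cvg_shiftS.
apply/cvgrPdist_lt => e e0; near=> n.
rewrite sub0r normrN -ltr_sqr ?nnegrE ?(ltW e0)// -inner_norm.
apply: le_lt_trans (step n) _; near: n.
by apply: cvgr_lt b0 _ _; rewrite exprn_gt0.
Unshelve. all: by end_near. Qed.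

Lemma linear_firm_decomp v : exists d, [/\ N d = d,
  (fun n => iter n N (v - d)) @ \oo --> (0 : X)
  & forall f, N f = f -> '[f, v - d] = 0].
Proof.
pose C0 := [set c | (fun n => iter n N c) @ \oo --> (0 : X)].
have C0P a u w : C0 u -> C0 w -> C0 (a *: u + w).
  move=> Cu Cw; have -> : C0 (a *: u + w) =
      ((fun n => a *: iter n N u + iter n N w) @ \oo --> a *: (0 : X) + 0).
    by rewrite scaler0 addr0 /C0 /=; under eq_fun do rewrite iterPZ.
  by apply: cvgD => //; apply: cvgZl_tmp.
have C00 : C0 0.
  rewrite /C0 /=; under eq_fun do rewrite -(subrr 0) iterB subrr.
  exact: cvg_cst.
have C0N u : C0 u -> C0 (- u).
  by move=> Cu; rewrite -[- u]addr0 -scaleN1r; exact: C0P.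
have [||s l Cs /cvgrPdist_lt sl|c Cc orth] := @proj_exists _ _ C0 v.
- by exists 0.
- move=> s t a Cs Ct; rewrite addrC; apply: (C0P) => //.
  by rewrite -[t]scale1r; apply: C0P => //; exact: C0N.
(* [C0] is closed because all powers of [N] are nonexpansive: one [s m] close to [l] serves for
   every [n]. *)
- apply/cvgrPdist_lt => e e0.
  have [m _ /(_ m (leqnn m)) /= lm] := sl (e / 2) (divr_gt0 e0 (ltr0Sn _ 1)).
  have /cvgrPdist_lt /(_ (e / 2)) := Cs m; rewrite divr_gt0// => /(_ isT).
  apply: filterS => n; rewrite !sub0r !normrN => h.
  have -> : iter n N l = iter n N (l - s m) + iter n N (s m) by rewrite iterB subrK.
  rewrite [e]splitr (le_lt_trans (ler_normD _ _))// ltrD//.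
  exact: le_lt_trans (iter_norm _ _) lm.
have orth0 w : C0 w -> '[v - c, w] = 0.
  move=> Cw; rewrite -[w](addrK c); apply: orth.
  by rewrite -[w]scale1r; exact: C0P.
(* Write [d] for [v - c]. As [d] is orthogonal to [d - N d], which lies in [C0], the square of
   [d - N d] is [- '[N d, d - N d]], at most 0 by firmness. *)
have Nd : N (v - c) = v - c.
  have h := orth0 _ (asymptotic_regularity (v - c)).
  apply/eqP; rewrite eq_sym -subr_eq0; apply/eqP/inner_eq0.
  have := firmN (v - c); have := inner_ge0 (v - c - N (v - c)).
  by rewrite [X in 0 <= X -> _]innerDl h innerDl h innerNl; lra.
exists (v - c); have -> : v - (v - c) = c by rewrite opprB addrC subrK.
split=> //.
(* The inner product of a fixed point with the iterates of [c] is constant and tends to 0. *)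
move=> f Nf; have inv n : '[f, iter n N c] = '[f, c].
  elim: n => //= n <-; have := Fix_orth_range (iter n N c) Nf.
  by rewrite innerDr innerNr; lra.
have h : (fun n => '[f, iter n N c]) @ \oo --> '[f, 0].
  by apply: cvg_inner => //; exact: cvg_cst.
rewrite (funext inv) linear0r in h.
exact/esym/(cvg_unique _ h (cvg_cst _)).
Qed.

Lemma lipschitz_linear_continuous (V W : normedModType R) (g : {linear V -> W}) k :
  0 < k -> (forall v, `|g v| <= k * `|v|) -> continuous g.
Proof.
move=> k0 gk v; apply/cvgrPdist_lt => e e0; apply/nbhs_normP.
exists (e / k) => /=; first exact: divr_gt0.
move=> w /= vw; rewrite -linearB (le_lt_trans (gk _))//.
by rewrite mulrC -ltr_pdivlMr.
Qed.

Lemma rV_linear_bounded n (g : {linear 'rV[R]_n -> X}) :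
  exists2 k : R, 0 < k & forall v, `|g v| <= k * `|v|.
Proof.
(* The extra 1 makes the bound positive, so that one can divide by it. *)
exists (\sum_(j < n) `|g (delta_mx 0 j)| + 1) => [|v].
  by rewrite ltr_wpDl// sumr_ge0.
rewrite {1}(row_sum_delta v) linear_sum mulrDl mul1r.
apply: le_trans (ler_norm_sum _ _ _) _; rewrite -[leLHS]addr0 lerD//.
rewrite mulr_suml; apply: ler_sum => j _; rewrite linearZ normrZ mulrC ler_wpM2l//.
by rewrite [leRHS]/Num.norm /= mx_normrE; apply/bigmax_geP; right; exists (0, j).
Qed.

(* The bound is the minimum of |c - N c| over the compact set of the c of
   coordinate norm 1 orthogonal to the fixed points. *)
Lemma findim_gap : finite_dimensional X -> exists2 m : R, 0 < m &
  forall c, (forall f, N f = f -> '[f, c] = 0) -> m * `|c| <= `|c - N c|.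
Proof.
move=> [n [f0 [linf [g0 fK gK]]]].
have [f [g [fgK gfK]]] : exists (f : {linear X -> 'rV[R]_n})
    (g : {linear 'rV[R]_n -> X}), cancel f g /\ cancel g f.
  pose f : {linear X -> 'rV[R]_n} :=
    HB.pack f0 (GRing.isLinear.Build R X 'rV[R]_n *:%R f0 linf).
  pose g : {linear 'rV[R]_n -> X} := HB.pack g0
    (GRing.isLinear.Build R 'rV[R]_n X *:%R g0 (can2_linear (f := f) fK gK)).
  by exists f, g.
have [k k0 gk] := rV_linear_bounded g.
have contg : continuous g := lipschitz_linear_continuous k0 gk.
have contN : continuous N.
  by apply: (lipschitz_linear_continuous ltr01) => v; rewrite mul1r linear_firm_norm.
pose S := [set v : 'rV[R]_n | `|v| = 1] `&`
  \bigcap_(p in [set p | N p = p]) [set v | '[p, g v] = 0].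
have cS : compact S.
  apply: bounded_closed_compact.
    by exists 1; split => // t t1 v [/= -> _]; exact: ltW.
  apply: closedI.
    apply: (@preimage_closed _ _ (fun v : 'rV[R]_n => `|v|) [set 1]).
      by move=> v _; exact: norm_continuous.
    exact: closed_eq.
  apply: closed_bigI => p _.
  apply: (@preimage_closed _ _ (fun v : 'rV[R]_n => '[p, g v]) [set 0]).
    by move=> v _; exact: (cvg_inner (cvg_cst p) (contg v)).
  exact: closed_eq.
have normalize c : (forall p, N p = p -> '[p, c] = 0) -> c != 0 ->
    S (`|f c|^-1 *: f c).
  move=> orth c0; have fc0 : `|f c| != 0.
    by rewrite normr_eq0; apply: contra c0 => /eqP fc0; rewrite -[c]fgK fc0 linear0.
  split=> /=; first by rewrite normrZ normfV normr_id mulVf.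
  by move=> p Np /=; rewrite linearZ/= fgK innerZr orth ?mulr0.
have [S0|S0] := pselect (S !=set0); last first.
  (* If [S] is empty, only 0 is orthogonal to all fixed points, and any constant will do. *)
  exists 1 => // c orth; have [->|c0] := eqVneq c 0; first by rewrite normr0 mulr0.
  by exfalso; apply: S0; eexists; exact: normalize c0.
have [v /set_mem Sv minv] : exists2 v, v \in S &
    forall t, t \in S -> `|g v - N (g v)| <= `|g t - N (g t)|.
  apply: (compact_EVT_min S0 cS); apply: continuous_subspaceT => v.
  exact: (cvg_norm (cvgB (contg v) (continuous_comp (contg v) (contN (g v))))).
(* Otherwise [g v] would be a fixed point orthogonal to itself, although [v] has norm 1. *)
have gv0 : 0 < `|g v - N (g v)|.
  rewrite normr_gt0; apply/eqP => /eqP; rewrite subr_eq0 eq_sym => /eqP Ngv.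
  have [/= v1 /(_ _ Ngv) /= /inner_eq0 gv] := Sv.
  by move: v1; rewrite -[v]gfK gv linear0 normr0 => /esym/eqP; rewrite oner_eq0.
(* Dividing by [k] passes from the coordinate norm to the norm of [X]. *)
exists (`|g v - N (g v)| / k) => [|c orth]; first exact: divr_gt0.
have [->|c0] := eqVneq c 0; first by rewrite normr0 mulr0.
have fc0 : 0 < `|f c|.
  by rewrite normr_gt0; apply: contra c0 => /eqP fc0; rewrite -[c]fgK fc0 linear0.
have := minv _ (mem_set (normalize _ orth c0)).
rewrite 2!linearZ /= fgK -scalerBr normrZ normfV normr_id => h.
have := gk (f c); rewrite fgK => ck.
have -> : `|c - N c| = `|f c| * (`|f c|^-1 * `|c - N c|) by rewrite mulVKf ?gt_eqF.
apply: le_trans (ler_wpM2l (ltW fc0) h); rewrite mulrAC ler_pdivrMr//.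
by rewrite -mulrA mulrCA (mulrC `|f c|) ler_wpM2l.
Qed.

Lemma findim_rate : finite_dimensional X -> exists mu : R, [/\ 0 <= mu, mu < 1 &
  forall c, (forall f, N f = f -> '[f, c] = 0) ->
    forall n, `|iter n N c| <= `|c| * mu ^+ n].
Proof.
move=> /findim_gap [m0 m00 gap0].
(* The cap at one half keeps [1 - m ^+ 2] nonnegative, where [Num.sqrt] is a true square root. *)
pose m := Num.min m0 2^-1.
have m_gt0 : 0 < m by rewrite lt_min m00 invr_gt0 ltr0n.
have m_le : m <= 2^-1 by rewrite ge_min lexx orbT.
have gap c : (forall f, N f = f -> '[f, c] = 0) -> m * `|c| <= `|c - N c|.
  by move=> /gap0; apply: le_trans; rewrite ler_wpM2r// ge_min lexx.
exists (Num.sqrt (1 - m ^+ 2)); split; first exact: sqrtr_ge0.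
  by rewrite -[ltRHS]sqrtr1 ltr_sqrt// gtrBl exprn_gt0.
move=> c orth n.
(* Orthogonality to the fixed points persists along the iterates, so the gap applies at every
   step. *)
have orthn k : forall f, N f = f -> '[f, iter k N c] = 0.
  elim: k => //= k IHk f Nf; have := Fix_orth_range (iter k N c) Nf.
  by rewrite innerDr innerNr IHk// sub0r => /eqP; rewrite oppr_eq0 => /eqP.
elim: n => [|n IHn]; first by rewrite mulr1.
rewrite iterS exprSr mulrA; apply: le_trans (ler_wpM2r (sqrtr_ge0 _) IHn).
have := gap _ (orthn n); move: (iter n N c) => u gapu.
rewrite -ler_sqr ?nnegrE ?mulr_ge0 ?sqrtr_ge0// exprMn sqr_sqrtr; last by nra.
have := linear_firm_le u; rewrite !inner_norm.
have : (m * `|u|) ^+ 2 <= `|u - N u| ^+ 2.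
  by rewrite ler_sqr ?nnegrE ?mulr_ge0// ltW.
by rewrite exprMn; lra.
Qed.
End Iterates.

(** * Transfer to affine maps by moving a fixed point to the origin *)

Section AffineIterates.
Set Implicit Arguments.
Unset Strict Implicit.
Context {R : realType} {X : hilbertType R}.
Variable F : X -> X.
Hypotheses (affF : affine_map F) (firmF : firmly_nonexpansive F).

Lemma affine_map_linear p : F p = p ->
  exists N : {linear X -> X}, forall v, F (p + v) = p + N v.
Proof.
move=> Fp; pose N v := F (p + v) - p.
have linN : linear N.
  move=> a u v; rewrite /N.
  have -> : p + (a *: u + v) = (p + v) + a *: ((p + u) - p).
    by apply: inner_inj => w; rewrite !innerE; ring.
  by rewrite affF Fp addrAC addrC.
pose N' : {linear X -> X} := HB.pack N (GRing.isLinear.Build R X X *:%R N linN).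
by exists N' => v; rewrite /N' /= /N addrCA subrr addr0.
Qed.

(** The orthogonality clause is the form in which [proj_orth] recognises [d] as the projection of
    [x] onto the fixed points. *)
Lemma affine_firm_limit x : Fix F !=set0 -> exists d, [/\ F d = d,
  forall f, F f = f -> '[x - d, f - d] = 0,
  (fun n => iter n F x) @ \oo --> d
  & finite_dimensional X -> exists mu : R, [/\ 0 <= mu, mu < 1 &
      forall n, `|iter n F x - d| <= `|x - d| * mu ^+ n]].
Proof.
move=> [p Fp]; have [N NE] := affine_map_linear Fp.
have firmN v : 0 <= '[N v, v - N v].
  have := firmF (p + v) p; rewrite NE Fp subrr subr0 addrAC subrr add0r.
  by rewrite opprD addrACA subrr add0r.
have iterE n v : iter n F (p + v) = p + iter n N v.
  by elim: n => //= n ->; rewrite NE.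
have FixN f : F f = f -> N (f - p) = f - p.
  by move=> Ff; apply: (@addrI _ p); rewrite -NE addrC subrK.
have [d [Nd dcvg orth]] := linear_firm_decomp firmN (x - p).
have iterd n : iter n F x - (p + d) = iter n N (x - p - d).
  have -> : iter n F x = p + iter n N (x - p) by rewrite -iterE addrC subrK.
  rewrite [in RHS]iterB opprD addrACA subrr add0r; congr (_ - _).
  by elim: n => //= n <-.
exists (p + d); split.
- by rewrite NE Nd.
(* Both [f - p] and [d] are fixed by [N], hence orthogonal to [x - p - d]. *)
- move=> f Ff; rewrite opprD addrA (addrA f) innerC innerDl.
  by rewrite orth ?FixN// innerNl orth// oppr0 addr0.
- apply/cvgrPdist_lt => e e0; move/cvgrPdist_lt : dcvg => /(_ e e0).
  by apply: filterS => n; rewrite sub0r normrN -iterd distrC.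
- move=> /(findim_rate firmN) [mu [mu0 mu1 rate]]; exists mu; split => // n.
  by rewrite iterd opprD addrA; apply: rate.
Qed.
End AffineIterates.

Theorem theorem5p1 (R : realType) (X : hilbertType R) (A B : X -> set X)
    (maxA : maximally_monotone A) (affA : affine_relation A)
    (maxB : maximally_monotone B) (affB : affine_relation B)
    (Z_neq0 : primal_sol A B !=set0) (x : X) :
  let T := DR A B in
  let Z := primal_sol A B in
  let K := dual_sol A B in
  [/\ (* (i) *)
      (fun n => iter n T x) @ \oo --> proj (Fix T) x,
      (* (ii) *)
      (paramonotone A -> paramonotone B -> orthogonal_sets K (pairwise_diff Z Z) ->
         (fun n => resolvent A (iter n T x)) @ \oo --> proj Z x),
      (* the sufficient condition mentioned in (ii) *)
      (paramonotone A -> paramonotone B -> zer A `&` zer B !=set0 ->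
         orthogonal_sets K (pairwise_diff Z Z))
    & (* (iii) *)
      (finite_dimensional X ->
         linear_cvg (fun n => iter n T x) (proj (Fix T) x) /\
         linear_cvg (fun n => resolvent A (iter n T x))
                    (resolvent A (proj (Fix T) x)))].
Proof.
move=> T Z K.
have firmT : firmly_nonexpansive T by exact: DR_firm.
have affT : affine_map T by exact: DR_affine.
have FixT0 : Fix T !=set0.
  have [z /primal_solE [k Azk Bzk]] := Z_neq0.
  by exists (z + k); exact: Fix_DR.
have [d [Td orthd cvgd rated]] := affine_firm_limit affT firmT x FixT0.
have -> : proj (Fix T) x = d by apply: proj_orth.
split => //.
- move=> paraA paraB KZ.
  pose a := resolvent A d; pose k := d - a.
  have [Aa Ba] := Fix_DR_split maxA affA maxB affB Td.
  have Kk : K k by apply/dual_solE; exists a.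
  have Za : Z a by apply/primal_solE; exists k.
  have -> : proj Z x = a.
    apply: proj_orth => // z Zz.
    (* By paramonotonicity [z + k] is a fixed point, so [x - d] is orthogonal to
       [z + k - d = z - a]; the remaining part [k] of [x - a] is so by [KZ]. *)
    have [Az Bz] := paramonotone_sol paraA paraB Zz Kk.
    have := orthd _ (Fix_DR maxA maxB Az Bz).
    have -> : z + k - d = z - a.
      by rewrite /k; apply: inner_inj => t; rewrite !innerE; ring.
    have -> : x - a = (x - d) + k by rewrite /k addrA subrK.
    rewrite innerDl => ->; rewrite add0r; apply: KZ => //.
    by exists z => //; exists a.
  exact: (firmly_nonexpansive_cvg (resolvent_firm maxA affA)).
- move=> paraA paraB [z0 [Az0 Bz0]] k _ Kk [z Zz [z' Zz' <-]].
  (* A common zero makes 0 a dual solution. Then [A] relates every primal solution to both [k] and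
     0, and monotonicity used in both orders forces equality. *)
  have K0 : K 0 by apply/dual_solE; exists z0; rewrite ?oppr0.
  have key w w' : Z w -> Z w' -> 0 <= '[w - w', k].
    move=> Zw Zw'; have [Aw _] := paramonotone_sol paraA paraB Zw Kk.
    have [Aw' _] := paramonotone_sol paraA paraB Zw' K0.
    by have := maxA.1 _ _ _ _ Aw Aw'; rewrite subr0.
  have := key _ _ Zz Zz'; have := key _ _ Zz' Zz.
  rewrite -(opprB z) innerNl innerC; lra.
(* The resolvent is nonexpansive, so the same constants serve for both sequences. *)
- move=> /rated [mu [mu0 mu1 rate]]; split; exists mu, `|x - d|; split => // n.
  apply: le_trans (rate n).
  exact: firmly_nonexpansive_dist (resolvent_firm maxA affA).
Qed.
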